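(* Let $\alpha\neq 0$ be a real number and let $\vec v\in\mathbb R_1^3$. If $\Sigma\subset\mathbb R_1^3$ is a spacelike surface of revolution with lightlike rotation axis that is a $K^\alpha$-translator with speed $\vec v$, then $\vec v$ is parallel to the rotation axis of $\Sigma$.
   Context: $\mathbb R_1^3$ is $\mathbb R^3$ with the metric $\langle,\rangle=dx^2+dy^2-dz^2$. A surface is spacelike if its induced metric is Riemannian; then its unit normal $N$ satisfies $\langle N,N\rangle=\epsilon=-1$. The Gauss curvature is $K=\epsilon\det(A)$, where $AU=-\nabla^0_U N$ is the Weingarten map and $\nabla^0$ is the Levi-Civita connection of $\mathbb R_1^3$. In a local parametrization $X(u,v)$, $$K=-\frac{\det(X_u,X_v,X_{uu})\det(X_u,X_v,X_{vv})-\det(X_u,X_v,X_{uv})^2}{(EG-F^2)^2},$$ where $E=\langle X_u,X_u\rangle$, $F=\langle X_u,X_v\rangle$, $G=\langle X_v,X_v\rangle$. A spacelike surface is a $K^\alpha$-translator with speed $\vec v$ if $K>0$ and $K^\alpha=\langle N,\vec v\rangle$ everywhere, for a choice of unit normal $N$. A surface of revolution with lightlike axis is, after a rigid motion of $\mathbb R_1^3$, one whose axis is spanned by $(0,1,1)$, parametrized by $X(r,t)=(2rt,\,f(r)+r-rt^2,\,f(r)-r-rt^2)$ with $f$ smooth on an interval of $r>0$; it is spacelike iff $f'>0$. *)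

(* Defs.v *)
From mathcomp Require Import all_boot all_order all_algebra.
From mathcomp Require Import all_classical all_reals all_analysis.
Set Implicit Arguments.
Unset Strict Implicit.
Unset Printing Implicit Defensive.
Import Order.TTheory GRing.Theory Num.Theory.
Import numFieldNormedType.Exports.
Local Open Scope classical_set_scope.
Local Open Scope ring_scope.

Section MinkowskiSpace.
Context {R : realType}.
Local Notation E3 := 'rV[R]_3.

Definition vec3 (x y z : R) : E3 := \row_(j < 3) [:: x; y; z]`_j.

(** The metric dx^2 + dy^2 - dz^2. *)
Definition mink (x y : E3) : R :=
  x 0 0 * y 0 0 + x 0 1 * y 0 1 - x 0 2 * y 0 2.

(** Time- and orientation-reversing isometries are allowed. *)
Definition rigid_motion (phi : E3 -> E3) : Prop :=
  exists (M : 'M[R]_3) (b : E3),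
    (forall x y, mink (x *m M) (y *m M) = mink x y) /\
    (forall x, phi x = x *m M + b).

(** [v] belongs to the direction space of the affine line [l]. *)
Definition parallel_to_line (v : E3) (l : set E3) : Prop :=
  exists p q, [/\ l p, l q & v = q - p].

(** A surface is given by a parametrization [X] of open domain [D]; the values
    outside [D] of [X], and of vector fields along [X], are irrelevant. *)
Section Surface.
Variables (D : set (R * R)) (X : R * R -> E3).

(** The rows are the two partial derivatives. *)
Definition jac (Y : R * R -> E3) (p : R * R) : 'M[R]_(2, 3) :=
  \matrix_(i < 2) (if i == 0 then 'D_((1, 0) : R * R) Y p
                   else 'D_((0, 1) : R * R) Y p).

Definition spacelike : Prop :=
  forall p, D p -> forall w : R * R, w != 0 ->
    0 < mink ('D_w X p) ('D_w X p).

(** A unit normal field of a spacelike surface, as a map on the parameter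
    domain: its values are timelike, with <N, N> = -1. *)
Definition unit_normal (N : R * R -> E3) : Prop :=
  forall p, D p ->
    [/\ differentiable N p,
        forall w : R * R, mink (N p) ('D_w X p) = 0
      & mink (N p) (N p) = -1].

(** The matrix of the Weingarten map [A U = - D_U N] in the basis [X_u, X_v] of
    the tangent plane, the i-th row being the image of the i-th basis vector.
    As the derivatives of [N] are tangent, multiplying by [pinvmx (jac X p)]
    returns their coordinates in this basis; see [weingartenE]. *)
Definition weingarten (N : R * R -> E3) (p : R * R) : 'M[R]_2 :=
  - jac N p *m pinvmx (jac X p).

Lemma weingartenE N p : (jac N p <= jac X p)%MS ->
  weingarten N p *m jac X p = - jac N p.
Proof. by move=> sNX; rewrite mulmxKpV // eqmx_opp. Qed.

(** [K = epsilon det A], where [epsilon = <N, N>]. *)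
Definition gauss_curvature (N : R * R -> E3) (p : R * R) : R :=
  mink (N p) (N p) * \det (weingarten N p).

Definition K_translator (alpha : R) (v : E3) : Prop :=
  exists N, unit_normal N /\
    forall p, D p ->
      0 < gauss_curvature N p /\
      gauss_curvature N p `^ alpha = mink (N p) v.

Definition smooth_on (I : set R) (f : R -> R) : Prop :=
  forall (n : nat) r, I r -> derivable (derive1n n f) r 1.

Definition standard_revolution (f : R -> R) (p : R * R) : E3 :=
  let: (r, t) := p in
  vec3 (2 * r * t) (f r + r - r * t ^+ 2) (f r - r - r * t ^+ 2).

(** [X] on [D] is a surface of revolution with lightlike rotation axis [l]. *)
Definition lightlike_revolution (l : set E3) : Prop :=
  exists (phi : E3 -> E3) (I : set R) (f : R -> R),
    [/\ rigid_motion phi,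
        [/\ open I, is_interval I, I !=set0 & I `<=` [set r | 0 < r]],
        smooth_on I f,
        D = I `*` setT /\
        (forall p, D p -> X p = phi (standard_revolution f p))
      & l = phi @` [set c *: vec3 0 1 1 | c in setT]].

End Surface.
End MinkowskiSpace.

(* Main.v *)
Require Import Defs.
From mathcomp Require Import all_boot all_order all_algebra.
From mathcomp Require Import all_classical all_reals all_analysis.
From mathcomp Require Import ring lra.
Set Implicit Arguments.
Unset Strict Implicit.
Unset Printing Implicit Defensive.
Import Order.TTheory GRing.Theory Num.Theory.
Import numFieldNormedType.Exports.
Local Open Scope classical_set_scope.
Local Open Scope ring_scope.

(** In standard position, write [w] for the difference of the last two coordinates
    of the normal. Orthogonality to [X_r] and [X_t] and normalization give
      [N = w (t, (1 - f' - t^2)/2, (-1 - f' - t^2)/2)]  with  [w^2 f' = 1].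
    Differentiating, [N_r = (w_r / 2) X_r] and [N_t = (w / 2r) X_t], so
    [K = f'' / (8 r f'^2)] does not depend on [t]. For a translator
    [f' <N, v>^2] is then constant in [t]; it is also the square of a polynomial
    of degree at most 2 in [t], which is therefore constant: [v_1 = 0] and
    [v_2 = v_3]. Squaring avoids discussing the sign of [w]. *)

(** * Directional derivatives of matrix-valued maps and of maps on a product *)

Lemma is_derive_mxP (R : realFieldType) (V : normedModType R) (m n : nat)
    (F : V -> 'M[R]_(m, n)) (p w : V) (dF : 'M[R]_(m, n)) :
  is_derive p w F dF <->
  forall i j, is_derive p w (fun q => F q i j) (dF i j).
Proof.
split=> [[dF1 <-] i j|dF1].
  have /derivable_mxP dFij := dF1.
  by apply: DeriveDef => //; rewrite derive_mx// mxE.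
have dF2 : derivable F p w by apply/derivable_mxP => i j; case: (dF1 i j).
apply: DeriveDef => //; rewrite derive_mx//; apply/matrixP => i j.
by rewrite mxE; case: (dF1 i j).
Qed.

Lemma is_derive_mulmxr (R : realFieldType) (V : normedModType R) (m n k : nat)
    (F : V -> 'M[R]_(m, n)) (p w : V) (dF : 'M[R]_(m, n)) (M : 'M[R]_(n, k)) :
  is_derive p w F dF -> is_derive p w (fun q => F q *m M) (dF *m M).
Proof.
move=> /is_derive_mxP dFij; apply/is_derive_mxP => i j.
have -> : (fun q => (F q *m M) i j) =
    \sum_(l < n) (M l j *: (fun q => F q i l)).
  apply/funext => q; rewrite mxE fct_sumE.
  by apply: eq_bigr => l _; rewrite mulrC.
rewrite mxE; have -> : \sum_l dF i l * M l j = \sum_(l < n) (M l j *: dF i l).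
  by apply: eq_bigr => l _; rewrite mulrC.
by apply: is_derive_sum => l; apply: is_deriveZ.
Qed.

Lemma is_derive_fst (R : numFieldType) (U V W : normedModType R) (g : U -> W)
    (p w : U * V) (dg : W) :
  is_derive p.1 w.1 g dg -> is_derive p w (g \o fst) dg.
Proof. by case=> dg1 dg2; apply: DeriveDef. Qed.

Lemma is_derive_snd (R : numFieldType) (U V W : normedModType R) (g : V -> W)
    (p w : U * V) (dg : W) :
  is_derive p.2 w.2 g dg -> is_derive p w (g \o snd) dg.
Proof. by case=> dg1 dg2; apply: DeriveDef. Qed.

(** Lets identities known only over [I] be differentiated: they hold on a neighbourhood of each
    point over [I]. *)
Lemma open_near_fst (U V : topologicalType) (I : set U) (p : U * V) :
  open I -> I p.1 -> \forall q \near p, I q.1.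
Proof.
move=> openI Ip; have : \forall q \near p, (fst @^-1` I) q.
  apply: (cvg_fst (F := nbhs p.1) (G := nbhs p.2)).
  exact: open_nbhs_nbhs.
by [].
Qed.

(** * The Minkowski form, and the standard parametrization with its normal *)

Section Minkowski.
Variable R : realType.
Implicit Types (x y v : 'rV[R]_3) (p w : R * R).

Lemma vec30 (a b c : R) : vec3 a b c 0 0 = a. Proof. by rewrite mxE. Qed.
Lemma vec31 (a b c : R) : vec3 a b c 0 1 = b. Proof. by rewrite mxE. Qed.
Lemma vec32 (a b c : R) : vec3 a b c 0 2 = c. Proof. by rewrite mxE. Qed.
Definition vec3E := (vec30, vec31, vec32).

Lemma vec3P x y :
  x 0 0 = y 0 0 -> x 0 1 = y 0 1 -> x 0 2 = y 0 2 -> x = y.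
Proof.
move=> e0 e1 e2; apply/rowP => -[[|[|[|//]]] lt3].
- by have -> : Ordinal lt3 = 0 by apply: val_inj.
- by have -> : Ordinal lt3 = 1 by apply: val_inj.
- by have -> : Ordinal lt3 = 2 by apply: val_inj.
Qed.

Lemma is_derive_vec3 (V : normedModType R) (p w : V) (a b c : V -> R)
    (da db dc : R) :
  is_derive p w a da -> is_derive p w b db -> is_derive p w c dc ->
  is_derive p w (fun q => vec3 (a q) (b q) (c q)) (vec3 da db dc).
Proof.
move=> dea deb dec; apply/is_derive_mxP => i j; rewrite mxE.
under eq_fun do rewrite mxE.
by case: j => -[|[|[|//]]].
Qed.

Lemma mink_nondeg x : (forall y, mink x y = 0) -> x = 0.
Proof.
move=> x0; apply: vec3P; rewrite mxE.
- by have := x0 (vec3 1 0 0); rewrite /mink !vec3E; lra.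
- by have := x0 (vec3 0 1 0); rewrite /mink !vec3E; lra.
- by have := x0 (vec3 0 0 1); rewrite /mink !vec3E; lra.
Qed.

(** A vector killed by [M] is orthogonal to every vector, hence zero by nondegeneracy. *)
Lemma mink_isometry_unit (M : 'M[R]_3) :
  (forall x y, mink (x *m M) (y *m M) = mink x y) -> M \in unitmx.
Proof.
move=> isoM; rewrite -row_free_unit; apply: inj_row_free => x xM0.
by apply: mink_nondeg => y; rewrite -isoM xM0 /mink !mxE; lra.
Qed.

(** Here [df] is the derivative of [f] in the direction [w.1], so it is 0 for the direction
    [(0, 1)]. *)
Lemma is_derive_standard_revolution (f : R -> R) p w df :
  is_derive p.1 w.1 f df ->
  is_derive p w (standard_revolution f)
    (vec3 (2 * (w.1 * p.2 + p.1 * w.2))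
          (df + w.1 - (w.1 * p.2 ^+ 2 + 2 * p.1 * p.2 * w.2))
          (df - w.1 - (w.1 * p.2 ^+ 2 + 2 * p.1 * p.2 * w.2))).
Proof.
move=> /is_derive_fst dfp.
have d1 : is_derive p w (fst : R * R -> R) w.1.
  by apply: (@is_derive_fst _ _ _ _ id); apply: is_derive_id.
have d2 : is_derive p w (snd : R * R -> R) w.2.
  by apply: (@is_derive_snd _ _ _ _ id); apply: is_derive_id.
have -> : standard_revolution f = fun q =>
    vec3 ((cst 2 * (fst * snd)) q)
         (((f \o fst) + fst - fst * snd ^+ 2) q)
         (((f \o fst) - fst - fst * snd ^+ 2) q).
  by apply/funext => -[r t] /=; rewrite -mulrA.
by apply: is_derive_vec3; apply: is_derive_eq;
  rewrite ?exprfctE /GRing.scale/= ?expr1; ring.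
Qed.

Lemma derive1_is_derive (f : R -> R) r :
  derivable f r 1 -> is_derive r 1 f (f^`()%classic r).
Proof. by move=> fr; rewrite derive1E; exact: derivableP. Qed.

(** With [a] for [f'], the two vectors are [X_r] and [X_t]. In the null coordinates [n1 - n2] and
    [n1 + n2] the system is triangular: [X_t] gives [n0 = w t], then [X_r] gives
    [n1 + n2 = - w (a + t^2)], and the norm is [n0^2 + w (n1 + n2)]. *)
Lemma standard_normal_coord (r t a : R) (n : 'rV[R]_3) (w := n 0 1 - n 0 2) :
  0 < r ->
  mink n (vec3 (2 * t) (a + 1 - t ^+ 2) (a - 1 - t ^+ 2)) = 0 ->
  mink n (vec3 (2 * r) (- (2 * r * t)) (- (2 * r * t))) = 0 ->
  mink n n = -1 ->
  [/\ n = vec3 (w * t) (w * ((1 - a - t ^+ 2) / 2))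
              (w * ((-1 - a - t ^+ 2) / 2))
    & w ^+ 2 * a = 1].
Proof.
rewrite /w /mink !vec3E => r0 e1 e2 e3.
have n0 : n 0 0 = (n 0 1 - n 0 2) * t.
  by apply: (mulfI (lt0r_neq0 r0)); lra.
have np : n 0 1 + n 0 2 = - (n 0 1 - n 0 2) * (a + t ^+ 2).
  by move: e1; rewrite n0; lra.
split; last first.
  have : n 0 0 * n 0 0 + (n 0 1 - n 0 2) * (n 0 1 + n 0 2) = -1.
    by rewrite -e3; ring.
  by rewrite np n0 => e; apply: oppr_inj; rewrite -e; ring.
by apply: vec3P; rewrite !vec3E //; lra.
Qed.

(** Both parameter directions are principal, so the Weingarten matrix is [- diag(c, d)]; the sign
    disappears from a determinant of size 2. *)
Lemma gauss_curvature_diag (X N : R * R -> 'rV[R]_3) p c d :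
  row_free (jac X p) ->
  'D_((1, 0) : R * R) N p = c *: 'D_((1, 0) : R * R) X p ->
  'D_((0, 1) : R * R) N p = d *: 'D_((0, 1) : R * R) X p ->
  gauss_curvature X N p = mink (N p) (N p) * (c * d).
Proof.
move=> freeX e1 e2; rewrite /gauss_curvature /weingarten.
have -> : jac N p = diag_mx (\row_(i < 2) if i == 0 then c else d) *m jac X p.
  apply/row_matrixP => i.
  rewrite row_mul row_diag_mx -scalemxAl -rowE !rowK !mxE.
  by case: ifP => _; [exact: e1|exact: e2].
rewrite mulNmx mulmxKp// -scaleN1r detZ sqrrN expr1n mul1r.
by rewrite det_diag big_ord_recl big_ord1 !mxE.
Qed.

(** * Normal and curvature of a surface of revolution moved by an isometry *)

Section StandardRevolution.
Variables (I : set R) (f : R -> R) (M : 'M[R]_3) (b : 'rV[R]_3).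
Variables (X N : R * R -> 'rV[R]_3).
Hypothesis openI : open I.
Hypothesis Ipos : I `<=` [set r | 0 < r].
Hypothesis f1 : forall r, I r -> derivable f r 1.
Hypothesis f2 : forall r, I r -> derivable (f^`()%classic) r 1.
Hypothesis isoM : forall x y, mink (x *m M) (y *m M) = mink x y.
Hypothesis XE : forall p, I p.1 -> X p = standard_revolution f p *m M + b.
Hypothesis normalN : unit_normal (I `*` setT) X N.

Let f' : R -> R := f^`()%classic.
Let f'' : R -> R := f'^`()%classic.
(** The normal brought back to standard position by the linear part of the motion; [w] is then its
    product with the axis direction [(0, 1, 1)]. *)
Let n p := N p *m invmx M.
Let w p := n p 0 1 - n p 0 2.

Let NE p : N p = n p *m M.
Proof. by rewrite /n mulmxKV// mink_isometry_unit. Qed.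

Let minkN p x : mink (N p) (x *m M) = mink (n p) x.
Proof. by rewrite NE isoM. Qed.

Let is_derive_X p u df : I p.1 -> is_derive p.1 u.1 f df ->
  is_derive p u X (vec3 (2 * (u.1 * p.2 + p.1 * u.2))
          (df + u.1 - (u.1 * p.2 ^+ 2 + 2 * p.1 * p.2 * u.2))
          (df - u.1 - (u.1 * p.2 ^+ 2 + 2 * p.1 * p.2 * u.2)) *m M).
Proof.
move=> Ip dfp.
have := is_derive_mulmxr M (is_derive_standard_revolution dfp).
move=> /(is_deriveD (is_derive_cst b p u)); rewrite add0r.
apply: near_eq_is_derive; near=> q.
by rewrite XE 1?addrC//; near: q; exact: open_near_fst.
Unshelve. all: by end_near. Qed.

Lemma derive_param_r p : I p.1 -> 'D_((1, 0) : R * R) X p =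
  vec3 (2 * p.2) (f' p.1 + 1 - p.2 ^+ 2) (f' p.1 - 1 - p.2 ^+ 2) *m M.
Proof.
move=> Ip.
case: (@is_derive_X p (1, 0) _ Ip (derive1_is_derive (f1 Ip))) => _ ->.
by congr (vec3 _ _ _ *m M); rewrite ?/f' /=; ring.
Qed.

Lemma derive_param_t p : I p.1 -> 'D_((0, 1) : R * R) X p =
  vec3 (2 * p.1) (- (2 * p.1 * p.2)) (- (2 * p.1 * p.2)) *m M.
Proof.
move=> Ip; case: (@is_derive_X p (0, 1) _ Ip (is_derive0 _ _)) => _ ->.
by congr (vec3 _ _ _ *m M); rewrite ?/f' /=; ring.
Qed.

Let nE p : I p.1 ->
  n p = vec3 (w p * p.2) (w p * ((1 - f' p.1 - p.2 ^+ 2) / 2))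
             (w p * ((-1 - f' p.1 - p.2 ^+ 2) / 2)) /\
  w p ^+ 2 * f' p.1 = 1.
Proof.
move=> Ip; have [] := @normalN p; first by split.
move=> _ Nt NN; case: (@standard_normal_coord p.1 p.2 (f' p.1) (n p)) => //.
- exact: Ipos.
- by have := Nt (1, 0); rewrite derive_param_r// minkN.
- by have := Nt (0, 1); rewrite derive_param_t// minkN.
- by rewrite -minkN -NE.
Qed.

(* Differentiates [w ^+ 2 * f' = 1] and [n = w * V]. *)
Let derive_n p u df : I p.1 -> is_derive p.1 u.1 f' df ->
  exists dw, 2 * w p * dw * f' p.1 + w p ^+ 2 * df = 0 /\
   'D_u N p =
    vec3 (dw * p.2 + w p * u.2)
         (dw * ((1 - f' p.1 - p.2 ^+ 2) / 2) - w p * (df / 2 + p.2 * u.2))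
         (dw * ((-1 - f' p.1 - p.2 ^+ 2) / 2) - w p * (df / 2 + p.2 * u.2)) *m M.
Proof.
move=> Ip /is_derive_fst dfp.
have [dN _ _] := @normalN p (conj Ip Logic.I).
have dn : is_derive p u n ('D_u N p *m invmx M).
  by apply: is_derive_mulmxr; apply: derivableP; exact: diff_derivable.
have dnij := (is_derive_mxP _ _ _ _).1 dn.
have dw : is_derive p u w
    (('D_u N p *m invmx M) 0 1 - ('D_u N p *m invmx M) 0 2).
  by have := is_deriveB (dnij 0 1) (dnij 0 2).
(* The witness is read off the derivative of [n], so no square root of [1 / f'] has to be chosen. *)
set dwp := (_ - _) in dw; exists dwp; split.
  have [] : is_derive p u (w ^+ 2 * (f' \o fst)) 0.
    apply: (near_eq_is_derive _ (is_derive_cst (1 : R) p u)); near=> q.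
    have [|_ /esym//] := @nE q.
    by near: q; exact: open_near_fst.
  move=> _ <-; have [_ ->] := is_deriveM (is_deriveX 2 dw) dfp.
  by rewrite exprfctE /GRing.scale/= expr1; ring.
have d2 : is_derive p u (snd : R * R -> R) u.2.
  by apply: (@is_derive_snd _ _ _ _ id); apply: is_derive_id.
(* The last two coordinates of [n] differ only in a constant: they are [V 1] and [V (-1)]. *)
pose V (k : R) : R * R -> R :=
  w * (cst 2^-1 * (cst k - (f' \o fst) - snd ^+ 2)).
have dV k : is_derive p u (V k)
    (dwp * ((k - f' p.1 - p.2 ^+ 2) / 2) - w p * (df / 2 + p.2 * u.2)).
  by apply: is_derive_eq; rewrite !fctE /GRing.scale/=; field.
transitivity ('D_u (fun q => vec3 ((w * snd) q) (V 1 q) (V (-1) q) *m M) p).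
  apply: near_eq_derive; near=> q.
  rewrite NE; have [|-> _] := @nE q; first by near: q; exact: open_near_fst.
  by congr (vec3 _ _ _ *m M); rewrite /V !fctE /=; field.
apply: derive_val; apply: is_derive_mulmxr; apply: is_derive_vec3.
by apply: is_derive_eq; rewrite /GRing.scale/=; ring.
Unshelve. all: by end_near. Qed.

(** The difference of the last two coordinates is 2 on [X_r] and 0 on [X_t], which kills the first
    coefficient; the first coordinate [2 r] of [X_t] then kills the second. *)
Lemma row_free_jac p : I p.1 -> row_free (jac X p).
Proof.
move=> Ip; have p10 : 0 < p.1 := Ipos Ip.
apply: inj_row_free => u; rewrite mulmx_sum_row big_ord_recl big_ord1 !rowK /=.
rewrite derive_param_r// derive_param_t// !scalemxAl -mulmxDl.
move=> /(congr1 (mulmx^~ (invmx M))).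
rewrite mulmxK ?mink_isometry_unit// mul0mx => /rowP e.
have := e 0; have := e 1; have := e 2; rewrite !mxE /= => e2 e1 e0.
have u00 : u 0 0 = 0 by lra.
have u01 : u 0 (lift ord0 ord0) = 0.
  have : u 0 (lift ord0 ord0) * p.1 = 0 by move: e0; rewrite u00; lra.
  by move=> /eqP; rewrite mulf_eq0 (gt_eqF p10) orbF => /eqP.
apply/rowP => i; rewrite mxE.
by case: (unliftP ord0 i) => [j|] ->; rewrite ?ord1.
Qed.

Lemma gauss_curvature_revolution p : I p.1 ->
  gauss_curvature X N p = f'' p.1 / (8 * p.1 * f' p.1 ^+ 2).
Proof.
move=> Ip; have p1n0 : p.1 != 0 := lt0r_neq0 (Ipos Ip); have [_ wf] := nE Ip.
have w0 : w p != 0.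
  by apply: contra_eq_neq wf => ->; rewrite expr0n mul0r eq_sym oner_eq0.
have f0 : f' p.1 != 0.
  by apply: contra_eq_neq wf => ->; rewrite mulr0 eq_sym oner_eq0.
have [dw [dwE Nr]] := @derive_n p (1, 0) _ Ip (derive1_is_derive (f2 Ip)).
have [dw' [dw'E Nt]] := @derive_n p (0, 1) _ Ip (is_derive0 _ _).
(* [w] does not vary with [t], because [f'] does not and neither factor of [w^2 f' = 1] vanishes. *)
have dw'0 : dw' = 0.
  apply/eqP; move/eqP: dw'E; rewrite mulr0 addr0 !mulf_eq0 pnatr_eq0.
  by rewrite (negPf w0) (negPf f0) !orbF.
have wf2 : w p * f'' p.1 = - (2 * dw * f' p.1).
  by apply: (mulfI w0); rewrite /f''; lra.
have [_ _ NN] := normalN (conj Ip Logic.I : (I `*` setT) p).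
rewrite (@gauss_curvature_diag X N p (dw / 2) (w p / (2 * p.1))).
- have w2 : w p ^+ 2 = (f' p.1)^-1 by apply: (mulIf f0); rewrite wf mulVf.
  (* Multiplying both sides by [w] lets [wf2] trade [f''] for [dw]. *)
  rewrite NN; apply: (mulfI w0); rewrite [RHS]mulrA wf2.
  transitivity (- (dw * w p ^+ 2) / (4 * p.1)); first by field.
  by rewrite w2; field; rewrite ?f0 ?p1n0.
- exact: row_free_jac.
- rewrite Nr derive_param_r// scalemxAl; congr (_ *m M).
  apply: vec3P; rewrite !mxE /=; first by field.
    by move: wf2; rewrite /f''; lra.
  by move: wf2; rewrite /f''; lra.
- rewrite Nt derive_param_t// scalemxAl; congr (_ *m M).
  by apply: vec3P; rewrite !mxE /= dw'0; field.
Qed.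

(** * The translator equation along a single orbit [r] of the rotations *)

Lemma translator_speed (alpha : R) v r : I r ->
  (forall t, gauss_curvature X N (r, t) `^ alpha = mink (N (r, t)) v) ->
  exists c : R, v = (c *: vec3 0 1 1) *m M.
Proof.
move=> Ir trans.
have [v' vE] : exists v', v = v' *m M.
  by exists (v *m invmx M); rewrite mulmxKV// mink_isometry_unit.
pose K := f'' r / (8 * r * f' r ^+ 2).
(* The translator equation squared and multiplied by [f'], which removes [w] through
   [w^2 f' = 1]. *)
have Pt t : (t * v' 0 0 + (1 - f' r - t ^+ 2) / 2 * v' 0 1
             + (1 + f' r + t ^+ 2) / 2 * v' 0 2) ^+ 2 =
            (K `^ alpha) ^+ 2 * f' r.
  have [nrt wf] := @nE (r, t) Ir.
  have := trans t; rewrite gauss_curvature_revolution// vE minkN nrt.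
  rewrite /mink !vec3E /= => ->.
  by rewrite -[LHS]mulr1 -[X in _ * X = _]wf /=; field.
(* The fourth finite difference at 0, 1, -1, 2, -2 annihilates the constant right-hand side and
   isolates the [t^4] coefficient, giving [6 (v'_2 - v'_1)^2 = 0]. *)
have A0 : v' 0 2 - v' 0 1 = 0.
  apply/eqP; rewrite -sqrf_eq0; apply/eqP.
  by have := (Pt 0, Pt 1, Pt (-1), Pt 2, Pt (-2)) => -[[[[]]]]; lra.
have v2 : v' 0 2 = v' 0 1 by lra.
(* The polynomial is now [t v'_0 + v'_1]; the second difference of its square is [2 v'_0^2]. *)
have B0 : v' 0 0 = 0.
  apply/eqP; rewrite -sqrf_eq0; apply/eqP.
  by move: (Pt 0) (Pt 1) (Pt (-1)); rewrite v2; lra.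
exists (v' 0 1); rewrite vE; congr (_ *m M).
by apply: vec3P; rewrite !mxE /= ?mulr0 ?mulr1 ?B0 ?v2.
Qed.

End StandardRevolution.
End Minkowski.

Theorem proposition3p10 (R : realType) (alpha : R) (v : 'rV[R]_3)
    (D : set (R * R)) (X : R * R -> 'rV[R]_3) (l : set 'rV[R]_3)
    (halpha : alpha != 0)
    (hspacelike : spacelike D X)
    (hrevolution : lightlike_revolution D X l)
    (htranslator : K_translator D X alpha v) :
  parallel_to_line v l.
Proof.
have [phi [I [f [[M [b [isoM phiE]]] [openI _ [r Ir] Ipos] smf [DE XE] lE]]]] :=
  hrevolution.
have [N [normalN trans]] := htranslator; rewrite {}DE in XE normalN trans.
have [c vE] : exists c : R, v = (c *: vec3 0 1 1) *m M.
  apply: (@translator_speed R I f M b X N openI Ipos _ _ isoM _ normalN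
            alpha v r Ir).
  - exact: smf 0%N.
  - exact: smf 1%N.
  - by move=> p Ip; rewrite XE ?phiE.
  - by move=> t; case: (trans (r, t)).
(* Two points of the axis whose difference cancels the translation part [b]. *)
exists (phi 0), (phi (c *: vec3 0 1 1)); split.
- by rewrite lE; exists 0 => //; exists 0; rewrite ?scale0r.
- by rewrite lE; exists (c *: vec3 0 1 1) => //; exists c.
- by rewrite !phiE mul0mx add0r addrK.
Qed.
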